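(* Consider the leader-follower system consisting of the leader $\dot{x}_r(t) = A x_r(t)$, $x_r(0)=x_{r0}$, and the $N$ followers $\dot{x}_i(t) = A x_i(t) + B u_i(t)$, $x_i(0)=x_{i0}$, $i=1,\dots,N$, with $(A,B)$ stabilizable, together with the associated cost functional $$J(u) = \int_0^\infty \Big[\tfrac12\sum_{i=1}^N\sum_{j=1}^N a_{ij}(x_i-x_j)^\top Q (x_i-x_j) + \sum_{i=1}^N g_i (x_i-x_r)^\top Q (x_i-x_r) + \sum_{i=1}^N u_i^\top R u_i\Big]\,dt .$$ Let $\lambda_1 \le \lambda_2\le\dots\le\lambda_N$ be the eigenvalues of the positive definite matrix $\Gamma = L+G$. Let $r>0$ be a given radius and let $\gamma>0$ be an a priori given upper bound for the cost. Let $c$ be any real number such that $0<c<\frac{2}{\lambda_N}$. We distinguish two cases: (a) If $\frac{2}{\lambda_1+\lambda_N}\le c<\frac{2}{\lambda_N}$, then there exists $P>0$ satisfying $$A^\top P + PA + (c^2\lambda_N^2-2c\lambda_N)PBR^{-1}B^\top P + \lambda_N Q<0.$$ (b) If $0<c<\frac{2}{\lambda_1+\lambda_N}$, then there exists $P>0$ satisfying $$A^\top P + PA + (c^2\lambda_1^2-2c\lambda_1)PBR^{-1}B^\top P + \lambda_N Q<0.$$ In both cases, if in addition such a $P$ satisfies $$P<\frac{\gamma}{r^2} I,$$ then the distributed control law $$u_i(t) = K\sum_{j=1}^N a_{ij}(x_i(t)-x_j(t)) + K g_i (x_i(t)-x_r(t)),\quad i=1,\dots,N,$$ with $K := -cR^{-1}B^\top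 P$ achieves tracking consensus for the controlled leader-follower system, and $J(K)<\gamma$ for all initial states $x_{r0}$ and $x_0=(x_{10}^\top,\dots,x_{N0}^\top)^\top$ satisfying $x_0-\mathbf{1}_N\otimes x_{r0}\in B(r)$.
   Context: Setting. $A\in\mathbb{R}^{n\times n}$, $B\in\mathbb{R}^{n\times m}$, $x_r,x_i\in\mathbb{R}^n$, $u_i\in\mathbb{R}^m$. The pair $(A,B)$ is assumed stabilizable. $Q\ge 0$ (an $n\times n$ real symmetric positive semidefinite matrix) and $R>0$ (an $m\times m$ real symmetric positive definite matrix) are given weighting matrices. The communication graph $\mathcal{G}$ between the $N$ followers is a connected simple undirected graph with node set $\{1,\dots,N\}$, $0/1$ adjacency matrix $\mathcal{A}=[a_{ij}]$ ($a_{ii}=0$) and Laplacian $L = D-\mathcal{A}$, where $D=\mathrm{diag}(d_1,\dots,d_N)$, $d_i=\sum_j a_{ij}$. The numbers $g_1,\dots,g_N$ are nonnegative reals with $g_i>0$ for at least one $i$ (at least one follower receives the leader's state), $G=\mathrm{diag}(g_1,\dots,g_N)$ and $\Gamma=L+G$, which is (symmetric) positive definite. Notation. For symmetric matrices, $P>0$ (resp. $<0$) means positive (resp. negative) definite, and $P<M$ means $M-P>0$; unknowns $P$ are real symmetric $n\times n$ matrices. $\mathbf{1}_N\in\mathbb{R}^N$ is the all-ones vector, $\otimes$ is the Kronecker product, and $B(r)=\{e\in\mathbb{R}^{nN} : \|e\|\le r\}$ with the Euclidean norm. Tracking consensus: the control law achieves tracking consensus if for all $i=1,\dots,N$ and for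 all initial states $x_{r0}$ and $x_{i0}$, the closed-loop trajectories satisfy $x_i(t)-x_r(t)\to 0$ as $t\to\infty$. $J(K)$ denotes the value of the cost functional $J(u)$ along the closed-loop trajectories obtained with the distributed control law with gain $K\in\mathbb{R}^{m\times n}$ from the given initial states. *)

(* Defs.v *)
From mathcomp Require Import all_boot all_order all_algebra.
From mathcomp Require Import all_classical all_reals all_analysis.
From mathcomp.real_closed Require Import complex mxtens.

Set Implicit Arguments.
Unset Strict Implicit.
Unset Printing Implicit Defensive.

Import Order.TTheory GRing.Theory Num.Theory.
Import numFieldNormedType.Exports.

Local Open Scope classical_set_scope.
Local Open Scope ring_scope.

(* [v^T M v], read off the 1 x 1 matrix. *)
Definition qform (R : realType) (n : nat) (M : 'M[R]_n) (v : 'cV[R]_n) : R :=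
  (v^T *m M *m v) 0 0.

Definition psd (R : realType) (n : nat) (M : 'M[R]_n) : Prop :=
  M^T = M /\ forall v : 'cV[R]_n, 0 <= qform M v.

Definition posdef (R : realType) (n : nat) (M : 'M[R]_n) : Prop :=
  M^T = M /\ forall v : 'cV[R]_n, v != 0 -> 0 < qform M v.

Definition negdef (R : realType) (n : nat) (M : 'M[R]_n) : Prop :=
  posdef (- M).

(* Library matrix norms are sup norms, hence the explicit Euclidean one. *)
Definition enorm (R : realType) (n : nat) (v : 'cV[R]_n) : R :=
  Num.sqrt (\sum_(k < n) v k 0 ^+ 2).

Definition hurwitz (R : realType) (n : nat) (M : 'M[R]_n) : Prop :=
  forall z : R[i],
    eigenvalue (map_mx (fun a : R => real_complex R a) M) z ->
    complex.Re z < 0.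

Definition stabilizable (R : realType) (n m : nat)
    (A : 'M[R]_n) (B : 'M[R]_(n, m)) : Prop :=
  exists F : 'M[R]_(m, n), hurwitz (A + B *m F).

Definition simple_connected_graph (N : nat) (e : rel 'I_N) : Prop :=
  [/\ symmetric e, irreflexive e & forall i j, connect e i j].

Definition adjacency (R : realType) (N : nat) (e : rel 'I_N) : 'M[R]_N :=
  \matrix_(i, j) (e i j)%:R.

Definition laplacian (R : realType) (N : nat) (a : 'M[R]_N) : 'M[R]_N :=
  diag_mx (\row_i \sum_(j < N) a i j) - a.

(* The eigenvalues of [M], with multiplicity, in nondecreasing order. *)
Definition ordered_spectrum (R : realType) (N : nat)
    (M : 'M[R]_N) (lam : N.-tuple R) : Prop :=
  sorted <=%R lam /\ char_poly M = \prod_(l <- lam) ('X - l%:P).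

(* The values of [z] at negative times are irrelevant; at 0 only one-sided
   continuity is asked, which makes the one-sided equation at 0 automatic
   when [f] is continuous on [0, +oo[. *)
Definition solves (R : realType) (n : nat)
    (z f : R -> 'cV[R]_n) : Prop :=
  {within `[0, +oo[, continuous z} /\
  forall t : R, 0 < t -> is_derive t 1 z (f t).

Definition leader_follower (R : realType) (n m N : nat)
    (A : 'M[R]_n) (B : 'M[R]_(n, m))
    (xr : R -> 'cV[R]_n) (x : 'I_N -> R -> 'cV[R]_n)
    (u : 'I_N -> R -> 'cV[R]_m) : Prop :=
  solves xr (fun t => A *m xr t) /\
  forall i, solves (x i) (fun t => A *m x i t + B *m u i t).

Definition control_law (R : realType) (n m N : nat)
    (a : 'M[R]_N) (g : 'I_N -> R) (K : 'M[R]_(m, n))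
    (xr : R -> 'cV[R]_n) (x : 'I_N -> R -> 'cV[R]_n)
    (i : 'I_N) (t : R) : 'cV[R]_m :=
  K *m (\sum_(j < N) a i j *: (x i t - x j t)) +
  K *m (g i *: (x i t - xr t)).

Definition closed_loop (R : realType) (n m N : nat)
    (A : 'M[R]_n) (B : 'M[R]_(n, m)) (a : 'M[R]_N) (g : 'I_N -> R)
    (K : 'M[R]_(m, n)) (xr : R -> 'cV[R]_n) (x : 'I_N -> R -> 'cV[R]_n)
    : Prop :=
  leader_follower A B xr x (control_law a g K xr x).

(* The closed-loop equation is linear, so its solution from given initial
   states exists and is unique on [0, +oo[; "the trajectories" are any solution. *)
Definition tracking_consensus (R : realType) (n m N : nat)
    (A : 'M[R]_n) (B : 'M[R]_(n, m)) (a : 'M[R]_N) (g : 'I_N -> R)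
    (K : 'M[R]_(m, n)) : Prop :=
  forall (xr0 : 'cV[R]_n) (x0 : 'I_N -> 'cV[R]_n)
         (xr : R -> 'cV[R]_n) (x : 'I_N -> R -> 'cV[R]_n),
    xr 0 = xr0 -> (forall i, x i 0 = x0 i) ->
    closed_loop A B a g K xr x ->
    forall i, x i t - xr t @[t --> +oo] --> (0 : 'cV[R]_n).

(* The integrand is nonnegative for psd [Q], [W] and [a], [g] >= 0, so the
   extended-real Lebesgue integral is the improper integral, with value +oo
   in case of divergence. *)
Definition cost (R : realType) (n m N : nat)
    (Q : 'M[R]_n) (W : 'M[R]_m) (a : 'M[R]_N) (g : 'I_N -> R)
    (xr : R -> 'cV[R]_n) (x : 'I_N -> R -> 'cV[R]_n)
    (u : 'I_N -> R -> 'cV[R]_m) : \bar R :=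
  (\int[@lebesgue_measure R]_(t in `[0%R, +oo[)
     (2^-1 * (\sum_(i < N) \sum_(j < N) a i j * qform Q (x i t - x j t))
      + \sum_(i < N) g i * qform Q (x i t - xr t)
      + \sum_(i < N) qform W (u i t))%:E)%E.

Definition cost_gain (R : realType) (n m N : nat)
    (Q : 'M[R]_n) (W : 'M[R]_m) (a : 'M[R]_N) (g : 'I_N -> R)
    (K : 'M[R]_(m, n))
    (xr : R -> 'cV[R]_n) (x : 'I_N -> R -> 'cV[R]_n) : \bar R :=
  cost Q W a g xr x (control_law a g K xr x).

Definition stack (R : realType) (n N : nat) (x0 : 'I_N -> 'cV[R]_n)
    : 'cV[R]_(N * n) :=
  \col_k x0 (mxtens_unindex k).1 (mxtens_unindex k).2 0.

Definition in_ball (R : realType) (n N : nat) (r : R)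
    (xr0 : 'cV[R]_n) (x0 : 'I_N -> 'cV[R]_n) : Prop :=
  enorm (stack x0 - (const_mx 1 : 'cV[R]_N) *t xr0) <= r.

Definition guaranteed_cost (R : realType) (n m N : nat)
    (A : 'M[R]_n) (B : 'M[R]_(n, m)) (Q : 'M[R]_n) (W : 'M[R]_m)
    (a : 'M[R]_N) (g : 'I_N -> R) (K : 'M[R]_(m, n)) (r gamma : R) : Prop :=
  forall (xr0 : 'cV[R]_n) (x0 : 'I_N -> 'cV[R]_n)
         (xr : R -> 'cV[R]_n) (x : 'I_N -> R -> 'cV[R]_n),
    xr 0 = xr0 -> (forall i, x i 0 = x0 i) ->
    closed_loop A B a g K xr x ->
    in_ball r xr0 x0 ->
    (cost_gain Q W a g K xr x < gamma%:E)%E.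

Definition riccati (R : realType) (n m : nat)
    (A : 'M[R]_n) (B : 'M[R]_(n, m)) (Q : 'M[R]_n) (W : 'M[R]_m)
    (k l : R) (P : 'M[R]_n) : 'M[R]_n :=
  A^T *m P + P *m A + k *: (P *m B *m invmx W *m B^T *m P) + l *: Q.

(* Main.v *)
Require Import Defs.
From mathcomp Require Import all_boot all_order all_algebra.
From mathcomp Require Import all_classical all_reals all_analysis.
From mathcomp Require Import measurable_realfun spectral sesquilinear mxred.
From mathcomp Require Import ring lra.
From mathcomp.real_closed Require Import complex mxtens.

(** Let [e_i = x_i - x_r] and [S = P B W^-1 B^T P].  In these errors the
    control law reads [u_i = K sum_j G_ij e_j], where [G] is the Laplacian plus
    the diagonal of the gains [g_i], and the first two terms of the cost density
    are the quadratic form of [G (x) Q].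

    Along the closed loop, [V = sum_i e_i^T P e_i] satisfies
    [V' + (cost density) = e^T (1 (x) M0 + G (x) M1 + G^2 (x) M2) e] with
    [M0 = A^T P + P A], [M1 = Q - 2 c S] and [M2 = c^2 S].  Diagonalising [G]
    decouples this form into one block
    [A^T P + P A + (c^2 d^2 - 2 c d) S + d Q] per eigenvalue [d].  The convex
    function [c^2 d^2 - 2 c d] is largest at an endpoint of [[l1, lN]]: at [lN]
    when [2 / (l1 + lN) <= c], at [l1] otherwise.  So every block lies below the
    single Riccati expression of the case at hand, which is negative definite
    ([closed_loop_dissipation]).  Hence [V' + (cost density) <= - delta V]: [V]
    tends to 0, which is consensus, and integration bounds the cost by [V(0)]
    ([lyapunov_cost_bound]).  Finally [V(0) < gamma] on the ball because
    [P < gamma / r^2].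

    The coefficient [k] of [S] is negative because [0 < d] (connectedness makes
    [G] positive definite) and [c d < 2].  For such [k] the Riccati inequality
    is solvable ([riccati_inequality_solvable]).  If [A + B F] is Hurwitz, it
    has a Lyapunov matrix [P0], built from a Schur triangularisation
    ([hurwitz_lyapunov]).  In [P = t P0] the feedback terms are absorbed by the
    quadratic term by completing a square; what remains of them does not
    depend on [t], so the Lyapunov decrease wins for large [t]. *)

Set Implicit Arguments.
Unset Strict Implicit.
Unset Printing Implicit Defensive.

Import Order.TTheory GRing.Theory Num.Theory.
Import numFieldNormedType.Exports.

Local Open Scope classical_set_scope.
Local Open Scope ring_scope.

(** * Bilinear forms *)

Definition bform (R : realType) n m (M : 'M[R]_(n, m)) (u : 'cV[R]_n)
  (v : 'cV[R]_m) : R := (u^T *m M *m v) 0 0.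

Lemma qform_bform (R : realType) n (M : 'M[R]_n) v : qform M v = bform M v v.
Proof. by []. Qed.

Section BilinearForm.
Variables (R : realType) (n m : nat).
Implicit Types (M : 'M[R]_(n, m)) (u : 'cV[R]_n) (v : 'cV[R]_m) (a : R).

Lemma bformE M u v : bform M u v = \sum_i \sum_j M i j * (u i 0 * v j 0).
Proof.
rewrite /bform mxE exchange_big /=; apply: eq_bigr => j _.
rewrite mxE mulr_suml; apply: eq_bigr => i _.
by rewrite mxE; ring.
Qed.

Lemma bform_suml M I (s : seq I) (P : pred I) F v :
  bform M (\sum_(i <- s | P i) F i) v = \sum_(i <- s | P i) bform M (F i) v.
Proof. by rewrite /bform linear_sum !mulmx_suml summxE. Qed.

Lemma bform_sumr M I (s : seq I) (P : pred I) F u :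
  bform M u (\sum_(i <- s | P i) F i) = \sum_(i <- s | P i) bform M u (F i).
Proof. by rewrite /bform mulmx_sumr summxE. Qed.

Lemma bformZl M a u v : bform M (a *: u) v = a * bform M u v.
Proof. by rewrite /bform linearZ /= -!scalemxAl mxE. Qed.

Lemma bformZr M a u v : bform M u (a *: v) = a * bform M u v.
Proof. by rewrite /bform -scalemxAr mxE. Qed.

Lemma bformDl M u u' v : bform M (u + u') v = bform M u v + bform M u' v.
Proof. by rewrite /bform linearD /= !mulmxDl mxE. Qed.

Lemma bformDr M u v v' : bform M u (v + v') = bform M u v + bform M u v'.
Proof. by rewrite /bform mulmxDr mxE. Qed.

Lemma bform_mxD M M' u v : bform (M + M') u v = bform M u v + bform M' u v.
Proof. by rewrite /bform mulmxDr mulmxDl mxE. Qed.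

Lemma bform_mxZ a M u v : bform (a *: M) u v = a * bform M u v.
Proof. by rewrite /bform -scalemxAr -scalemxAl mxE. Qed.

Lemma bform_mxN M u v : bform (- M) u v = - bform M u v.
Proof. by rewrite -scaleN1r bform_mxZ mulN1r. Qed.

Lemma bform_trmx M u v : bform M^T v u = bform M u v.
Proof.
rewrite /bform; transitivity ((v^T *m M^T *m u)^T 0 0); first by rewrite [RHS]mxE.
by rewrite !trmx_mul !trmxK mulmxA.
Qed.

Lemma bform_mull p (A : 'M[R]_(n, p)) M (u : 'cV[R]_p) v :
  bform M (A *m u) v = bform (A^T *m M) u v.
Proof. by rewrite /bform trmx_mul !mulmxA. Qed.

Lemma bform_mulr p (A : 'M[R]_(m, p)) M u (v : 'cV[R]_p) :
  bform M u (A *m v) = bform (M *m A) u v.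
Proof. by rewrite /bform !mulmxA. Qed.

End BilinearForm.

Lemma qform1 (R : realType) n (v : 'cV[R]_n) :
  qform 1%:M v = \sum_k v k 0 ^+ 2.
Proof. by rewrite /qform mulmx1 mxE; apply: eq_bigr => k _; rewrite mxE expr2. Qed.

Lemma qform1_ge0 (R : realType) n (v : 'cV[R]_n) : 0 <= qform 1%:M v.
Proof. by rewrite qform1 sumr_ge0 // => k _; exact: sqr_ge0. Qed.

Lemma qform1_gt0 (R : realType) n (v : 'cV[R]_n) : v != 0 -> 0 < qform 1%:M v.
Proof.
move=> v0; rewrite lt0r qform1_ge0 andbT; apply: contra v0; rewrite qform1.
rewrite psumr_eq0 => [/allP v0|k _]; last exact: sqr_ge0.
apply/eqP/colP => k; rewrite mxE.
by apply/eqP; rewrite -sqrf_eq0; exact: v0 (mem_index_enum k).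
Qed.

Lemma posdef_psd (R : realType) n (M : 'M[R]_n) : posdef M -> psd M.
Proof.
move=> [symM posM]; split=> // v; have [->|/posM/ltW//] := eqVneq v 0.
by rewrite /qform mulmx0 mxE.
Qed.

Lemma posdef_eigenvalue (R : realType) n (M : 'M[R]_n) d :
  posdef M -> eigenvalue M d -> 0 < d.
Proof.
move=> [_ posM] /eigenvalueP[v vM v0].
have v0' : v^T != 0 by rewrite trmx_eq0.
have := posM _ v0'; rewrite /qform trmxK vM -scalemxAl mxE.
rewrite pmulr_lgt0 // -[v in v *m _]trmxK -[v^T^T]mulmx1.
exact: qform1_gt0.
Qed.

Lemma posdef_unitmx (R : realType) n (M : 'M[R]_n) : posdef M -> M \in unitmx.
Proof.
move=> [_ posM]; rewrite -row_free_unit; apply/row_freeP.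
apply/row_freeP; rewrite -kermx_eq0; apply/eqP/row_matrixP => i; rewrite row0.
have kM : row i (kermx M) *m M = 0 by rewrite -row_mul mulmx_ker row0.
apply/eqP/negPn/negP => k0.
have /posM : (row i (kermx M))^T != 0 by rewrite trmx_eq0.
by rewrite /qform trmxK kM mul0mx mxE ltxx.
Qed.

Lemma psd_congruence (R : realType) n m (M : 'M[R]_n) (X : 'M[R]_(n, m)) :
  psd M -> psd (X^T *m M *m X).
Proof.
move=> [symM M0]; split=> [|v]; first by rewrite !trmx_mul trmxK symM mulmxA.
by rewrite qform_bform -bform_mulr -bform_mull; exact: M0.
Qed.

Lemma psd_invmx (R : realType) n (M : 'M[R]_n) : posdef M -> psd (invmx M).
Proof.
move=> posM; have [symM _] := posM.
have -> : invmx M = (invmx M)^T *m M *m invmx M.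
  by rewrite trmx_inv symM mulVmx ?mul1mx // posdef_unitmx.
exact/psd_congruence/posdef_psd.
Qed.

(** * Spectral decomposition of real symmetric matrices *)

Section Spectral.
Local Open Scope sesquilinear_scope.

Lemma expmx_diag (F : fieldType) n (A U : 'M[F]_n) (s : 'rV[F]_n) p :
  U \in unitmx -> A = invmx U *m diag_mx s *m U ->
  A ^+ p = invmx U *m diag_mx (\row_k s 0 k ^+ p) *m U.
Proof.
move=> unitU ->; elim: p => [|p IH].
  rewrite (_ : \row_k _ = const_mx 1); last by apply/rowP => k; rewrite !mxE.
  by rewrite diag_const_mx mulmx1 mulVmx.
rewrite exprS {}IH; change (@GRing.mul _) with (@mulmx F n n n).
rewrite !mulmxA mulmxK // -[X in X *m U]mulmxA mulmx_diag; do 2 congr (_ *m _).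
by congr diag_mx; apply/rowP => k; rewrite !mxE exprS.
Qed.

(** The complex spectral theorem gives [M = U^* D U] with [U] unitary and [D]
    real; [X] and [Y] are the real and imaginary parts of [U].  Taking real
    parts of [M^p = U^* D^p U] keeps everything over the reals, at the price of
    two real vectors per eigenvalue. *)
Lemma symmetric_spectral (R : realType) n (M : 'M[R]_n) : M^T = M ->
  exists (d : 'I_n -> R) (X Y : 'M[R]_n),
    (forall k, eigenvalue M (d k)) /\
    forall (p : nat) i j,
      (M ^+ p) i j = \sum_k d k ^+ p * (X k i * X k j + Y k i * Y k j).
Proof.
move=> symM; pose MC := map_mx (fun a : R => real_complex R a) M.
have hermMC : MC \is hermsymmx.
  apply: realsym_hermsym.
    apply/is_hermitianmxP; rewrite expr0 scale1r; apply/matrixP => i j.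
    by rewrite !mxE -[in LHS]symM mxE.
  by apply/mxOverP => i j; rewrite mxE; apply/complex_realP; exists (M i j).
have /orthomx_spectralP := hermitian_normalmx hermMC.
set U := spectralmx MC; set s := spectral_diag MC => MCE.
have unitU : U \is unitarymx := spectral_unitarymx MC.
have sreal k : s 0 k = real_complex R (complex.Re (s 0 k)).
  rewrite RRe_real //.
  by move/mxOverP: (hermitian_spectral_diag_real hermMC); apply.
exists (fun k => complex.Re (s 0 k)), (map_mx (@complex.Re R) U), (map_mx (@complex.Im R) U).
split=> [k|p i j].
  have: eigenvalue MC (s 0 k).
    apply/eigenvalueP; exists (row k U); last first.
      apply/eqP => /(congr1 (mulmx^~ (invmx U))); rewrite -row_mul mul0mx.
      rewrite mulmxV ?unitarymx_unit // => /rowP/(_ k)/eqP.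
      by rewrite !mxE eqxx oner_eq0.
    rewrite -row_mul [in LHS]MCE !mulmxA mulmxV ?unitarymx_unit // mul1mx.
    by rewrite row_mul row_diag_mx -scalemxAl -rowE.
  rewrite !eigenvalue_root_char sreal -map_char_poly /=.
  by rewrite fmorph_root.
have powMC := expmx_diag p (unitarymx_unit unitU) MCE.
have -> : (M ^+ p) i j = complex.Re ((MC ^+ p) i j).
  have -> : MC ^+ p = map_mx (fun a : R => real_complex R a) (M ^+ p).
    elim: p {powMC} => [|p IH]; first by rewrite map_mx1.
    by rewrite !exprS IH -[_ * _]/(_ *m _) -map_mxM.
  by rewrite mxE.
rewrite powMC invmx_unitary // mxE (raddf_sum (@complex.Re R : Rcomplex R -> R)).
apply: eq_bigr => k _; rewrite mul_mx_diag !mxE sreal -rmorphXn /=.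
case: (U k i) => a b; case: (U k j) => x y /=; ring.
Qed.

End Spectral.

Lemma finite_pos_lower_bound (R : realType) n (f : 'I_n -> R) :
  (forall i, 0 < f i) -> exists2 m : R, 0 < m & forall i, m <= f i.
Proof.
move=> f0; pose s := 1 + \sum_i (f i)^-1.
have s0 : 0 < s by rewrite ltr_pwDl // sumr_ge0 // => i _; rewrite invr_ge0 ltW.
exists s^-1 => [|i]; first by rewrite invr_gt0.
rewrite -[leRHS]invrK lef_pV2 ?posrE ?invr_gt0 // /s (bigD1 i) //=.
rewrite addrCA lerDl addr_ge0 // sumr_ge0 // => j _.
by rewrite invr_ge0 ltW.
Qed.

Lemma posdef_coercive (R : realType) n (M : 'M[R]_n) : posdef M ->
  exists2 d : R, 0 < d & forall v, d * qform 1%:M v <= qform M v.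
Proof.
move=> posM; have [d [X [Y [eigd specM]]]] := symmetric_spectral posM.1.
have dpos k : 0 < d k by exact: posdef_eigenvalue posM (eigd k).
have qE p v : qform (M ^+ p) v =
    \sum_k d k ^+ p * ((X *m v) k 0 ^+ 2 + (Y *m v) k 0 ^+ 2).
  rewrite qform_bform bformE; under eq_bigr do under eq_bigr do rewrite specM mulr_suml.
  under eq_bigr do rewrite exchange_big.
  rewrite exchange_big /=; apply: eq_bigr => k _.
  rewrite !expr2 !mxE !big_distrlr /= -big_split mulr_sumr; apply: eq_bigr => i _.
  rewrite -big_split mulr_sumr; apply: eq_bigr => j _ /=; ring.
have [s s0 sd] := finite_pos_lower_bound dpos.
exists s => // v; have := qE 0%N v; have := qE 1%N v.
rewrite expr1 expr0 => -> ->; rewrite mulr_sumr ler_sum // => k _.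
by rewrite expr0 mul1r expr1 ler_wpM2r // addr_ge0 ?sqr_ge0.
Qed.

Lemma qform_le (R : realType) n (S : 'M[R]_n) v :
  qform S v <= (\sum_i \sum_j `|S i j|) * qform 1%:M v.
Proof.
rewrite qform_bform bformE mulr_suml ler_sum // => i _; rewrite mulr_suml ler_sum // => j _.
rewrite (le_trans (ler_norm _)) // normrM ler_wpM2l //.
have le_sum k : v k 0 ^+ 2 <= qform 1%:M v.
  by rewrite qform1 (bigD1 k) //= lerDl sumr_ge0 // => l _; exact: sqr_ge0.
have [h|h] := lerP `|v i 0| `|v j 0|.
  rewrite (le_trans _ (le_sum j)) // normrM -[leRHS]ger0_norm ?sqr_ge0 //.
  by rewrite normrX expr2 ler_wpM2r.
rewrite (le_trans _ (le_sum i)) // normrM -[leRHS]ger0_norm ?sqr_ge0 //.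
by rewrite normrX expr2 ler_wpM2l // ltW.
Qed.

(** Comparison of an arbitrary form with a definite one; it provides the
    scaling of the Lyapunov matrix, the decay rate of the energy and the bound
    of the errors by the energy. *)
Lemma posdef_dominates (R : realType) n (H S : 'M[R]_n) : posdef H ->
  exists2 t : R, 0 < t & forall v, qform S v <= t * qform H v.
Proof.
move=> /posdef_coercive[d d0 dH]; pose c := 1 + \sum_i \sum_j `|S i j|.
have c0 : 0 < c.
  by rewrite ltr_pwDl // sumr_ge0 // => i _; rewrite sumr_ge0.
exists (c / d) => [|v]; first exact: divr_gt0.
rewrite (le_trans (qform_le S v)) //.
apply: (@le_trans _ _ (c * qform 1%:M v)).
  by rewrite ler_wpM2r ?qform1_ge0 // lerDr.
by rewrite -mulrA ler_wpM2l ?(ltW c0) // mulrC ler_pdivlMr // mulrC.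
Qed.

(** In an eigenbasis of [G] the form of
    [1 (x) M0 + G (x) M1 + G^2 (x) M2] is block diagonal, with the block
    [M0 + d M1 + d^2 M2] at each eigenvalue [d]. *)
Lemma kron_polynomial_le (R : realType) n N (G : 'M[R]_N) (M0 M1 M2 H : 'M[R]_n) :
  G^T = G ->
  (forall d, eigenvalue G d -> forall v,
     qform (M0 + d *: M1 + d ^+ 2 *: M2) v <= qform H v) ->
  forall z : 'I_N -> 'cV[R]_n,
    \sum_i qform M0 (z i) + \sum_i \sum_j G i j * bform M1 (z i) (z j)
      + \sum_i \sum_j (G *m G) i j * bform M2 (z i) (z j)
    <= \sum_i qform H (z i).
Proof.
move=> symG GH z; have [d [X [Y [eigd specG]]]] := symmetric_spectral symG.
pose x k := \sum_i X k i *: z i; pose y k := \sum_i Y k i *: z i.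
have qE M p : \sum_i \sum_j (G ^+ p) i j * bform M (z i) (z j) =
    \sum_k d k ^+ p * (qform M (x k) + qform M (y k)).
  under eq_bigr do under eq_bigr do rewrite specG mulr_suml.
  under eq_bigr do rewrite exchange_big.
  rewrite exchange_big /=; apply: eq_bigr => k _.
  rewrite -[qform M (x k)]/(bform M _ _) -[qform M (y k)]/(bform M _ _).
  rewrite !bform_suml -big_split mulr_sumr; apply: eq_bigr => i _ /=.
  rewrite !bformZl !bform_sumr !mulr_sumr -big_split mulr_sumr.
  by apply: eq_bigr => j _ /=; rewrite !bformZr; ring.
have q0 M : \sum_i qform M (z i) = \sum_k (qform M (x k) + qform M (y k)).
  transitivity (\sum_i \sum_j (G ^+ 0) i j * bform M (z i) (z j)).
    apply: eq_bigr => i _; rewrite (bigD1 i) //= expr0 mxE eqxx mul1r.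
    rewrite big1 ?addr0 // => j /negPf ji.
    by rewrite mxE eq_sym ji mul0r.
  by rewrite qE; apply: eq_bigr => k _; rewrite expr0 mul1r.
have q1 := qE M1 1%N; rewrite expr1 in q1.
have q2 : \sum_i \sum_j (G *m G) i j * bform M2 (z i) (z j) = _ := qE M2 2%N.
rewrite !q0 q1 q2 -!big_split ler_sum //= => k _.
have := GH _ (eigd k) (x k); have := GH _ (eigd k) (y k).
have E v : qform (M0 + d k *: M1 + d k ^+ 2 *: M2) v =
  qform M0 v + d k * qform M1 v + d k ^+ 2 * qform M2 v.
  by rewrite -[LHS]/(bform _ _ _) !bform_mxD !bform_mxZ.
rewrite !E; lra.
Qed.

(** * Lyapunov matrices of Hurwitz matrices *)

Section Lyapunov.
Local Open Scope sesquilinear_scope.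
Local Notation Re := complex.Re.
Local Notation normc := Normc.normc.

Lemma normc_ge0 (R : realType) (z : R[i]) : 0 <= normc z.
Proof. by case: z => a b; exact: sqrtr_ge0. Qed.

Lemma Re_le_normc (R : realType) (z : R[i]) : Re z <= normc z.
Proof.
case: z => a b /=; rewrite (le_trans (ler_norm _)) // -sqrtr_sqr ler_sqrt.
  by rewrite lerDl sqr_ge0.
by rewrite addr_ge0 ?sqr_ge0.
Qed.

Lemma normc_conj (R : realType) (z : R[i]) : normc (Num.conj z) = normc z.
Proof. by case: z => a b /=; rewrite sqrrN. Qed.

Lemma Re_conj_mul (R : realType) (z t : R[i]) :
  Re (Num.conj z * (t * z)) = Re t * normc z ^+ 2.
Proof.
case: z => a b; case: t => x y /=; rewrite sqr_sqrtr; last first.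
  by rewrite addr_ge0 ?sqr_ge0.
ring.
Qed.

Lemma Re_conj_sqr (R : realType) (z : R[i]) : Re (Num.conj z * z) = normc z ^+ 2.
Proof. by rewrite -{2}[z]mul1r Re_conj_mul mul1r. Qed.

Lemma Re_sum (R : realType) I (s : seq I) (F : I -> R[i]) :
  Re (\sum_(i <- s) F i) = \sum_(i <- s) Re (F i).
Proof. exact: (raddf_sum (@complex.Re R : Rcomplex R -> R)). Qed.

(** Weighting the [k]-th coordinate by [e^k] multiplies the strictly lower
    triangular entries of [T] by positive powers of [e], so for small [e] the
    diagonal decides the sign. *)
Lemma trig_dissipative (R : realType) n (T : 'M[R[i]]_n) :
  is_trig_mx T -> (forall i, Re (T i i) < 0) ->
  exists2 e : R, 0 < e & forall y : 'cV_n, y != 0 ->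
    \sum_(k < n) e ^+ k.*2 * Re (Num.conj (y k 0) * (T *m y) k 0) < 0.
Proof.
move=> /is_trig_mxP trigT diagT.
have [mu mu0 muT] : exists2 mu : R, 0 < mu & forall i, mu <= - Re (T i i).
  by apply: finite_pos_lower_bound => i; rewrite oppr_gt0.
pose c := \sum_i \sum_j normc (T i j).
have c0 : 0 <= c by do 2! rewrite sumr_ge0 // => ? _; exact: normc_ge0.
(* chosen so that [e <= 1] and [e * c < mu] *)
pose e := mu / (mu + c).
have e0 : 0 < e by rewrite divr_gt0 // ltr_pwDl.
have e1 : e <= 1 by rewrite ler_pdivrMr ?ltr_pwDl // mul1r lerDl.
have ec : e * c < mu.
  by rewrite /e mulrAC ltr_pdivrMr ?ltr_pwDl // ltr_pM2l // ltrDr.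
exists e => // y y0; pose w (k : 'I_n) := e ^+ k * normc (y k 0).
have w0 k : 0 <= w k by rewrite mulr_ge0 ?exprn_ge0 ?normc_ge0 // ltW.
have wE k : w k ^+ 2 = e ^+ k.*2 * normc (y k 0) ^+ 2.
  by rewrite exprMn -exprM muln2.
pose S := \sum_k w k ^+ 2.
have S0 : 0 < S.
  rewrite lt0r sumr_ge0 ?andbT => [|k _]; last exact: sqr_ge0.
  apply: contra y0; rewrite psumr_eq0 => [/allP y0|k _]; last exact: sqr_ge0.
  apply/eqP/colP => k; rewrite mxE; apply: Normc.eq0_normc; apply/eqP.
  have := y0 k (mem_index_enum k).
  by rewrite /= sqrf_eq0 mulf_eq0 expf_eq0 (gt_eqF e0) andbF.
have wS k : w k ^+ 2 <= S.
  by rewrite /S (bigD1 k) //= lerDl sumr_ge0 // => l _; exact: sqr_ge0.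
have wwS k l : w k * w l <= S.
  by have := wS k; have := wS l; have := sqr_ge0 (w k - w l); lra.
have term (k l : 'I_n) : e ^+ k.*2 * Re (Num.conj (y k 0) * (T k l * y l 0)) <=
    (k == l)%:R * (- mu * w k ^+ 2) + e * normc (T k l) * S.
  have t0 := normc_ge0 (T k l).
  have h : 0 <= e * normc (T k l) * S by rewrite mulr_ge0 ?(ltW S0) // mulr_ge0 // ltW.
  case: (ltngtP k l) => [kl|lk|/val_inj kl].
  - rewrite -val_eqE ltn_eqF // mul0r add0r (le_trans _ h) //.
    by rewrite trigT // mul0r mulr0 /= mulr0.
  (* below the diagonal the weights leave a factor [e ^+ (k - l) <= e] *)
  - rewrite -val_eqE gtn_eqF // mul0r add0r.
    apply: (@le_trans _ _ (e ^+ k.*2 * (normc (y k 0) * (normc (T k l) * normc (y l 0))))).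
      rewrite ler_wpM2l ?exprn_ge0 ?(ltW e0) // (le_trans (Re_le_normc _)) //.
      by rewrite !Normc.normcM normc_conj.
    have -> : e ^+ k.*2 * (normc (y k 0) * (normc (T k l) * normc (y l 0))) =
        e ^+ (k - l) * normc (T k l) * (w k * w l).
      rewrite /w -addnn -[X in e ^+ (X + _)](subnK (ltnW lk)) !exprD.
      ring.
    apply: ler_pM => //; rewrite ?mulr_ge0 ?normc_ge0 ?exprn_ge0 ?(ltW e0) //.
    rewrite ler_wpM2r // -[leRHS]expr1 ler_wiXn2l ?(ltW e0) //.
    by rewrite subn_gt0.
  - rewrite -kl in h *; rewrite eqxx mul1r Re_conj_mul wE.
    rewrite ler_wpDr // mulrCA ler_wpM2r ?mulr_ge0 ?sqr_ge0 ?normc_ge0 ?exprn_ge0 ?(ltW e0) //.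
    by rewrite lerNr muT.
apply: (@le_lt_trans _ _ (\sum_k \sum_l ((k == l)%:R * (- mu * w k ^+ 2) +
    e * normc (T k l) * S))).
  apply: ler_sum => k _; rewrite mxE mulr_sumr Re_sum mulr_sumr.
  by apply: ler_sum => l _; exact: term.
have -> : \sum_k \sum_l ((k == l)%:R * (- mu * w k ^+ 2) + e * normc (T k l) * S) =
    (e * c - mu) * S.
  transitivity (\sum_k (- mu * w k ^+ 2 + (\sum_l normc (T k l)) * (e * S))).
    apply: eq_bigr => k _; rewrite big_split /= (bigD1 k) //= eqxx mul1r.
    rewrite big1 ?addr0 => [|l /negPf kl]; last by rewrite eq_sym kl mul0r.
    by rewrite mulr_suml; congr (_ + _); apply: eq_bigr => l _; ring.
  by rewrite big_split /= -mulr_sumr -mulr_suml -/S -/c; ring.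
by rewrite pmulr_llt0 // subr_lt0.
Qed.

(** In a Schur basis the matrix is triangular with diagonal entries of negative
    real part, so the weighted Hermitian norm of that basis decreases; its real
    part is the required real form. *)
Lemma hurwitz_lyapunov (R : realType) n (M : 'M[R]_n) : hurwitz M ->
  exists P : 'M[R]_n, posdef P /\ posdef (- (M^T *m P + P *m M)).
Proof.
move=> hurM; have [n0|n_gt0] := posnP n.
  have v0 (v : 'cV[R]_n) : v = 0.
    by apply/colP => k; move: (ltn_ord k); rewrite {2}n0.
  have p0 (N : 'M[R]_n) : posdef N.
    split=> [|v]; last by rewrite (v0 v) eqxx.
    by apply/matrixP => k; move: (ltn_ord k); rewrite {2}n0.
  by exists 0; split; exact: p0.
pose toC a : R[i] := real_complex R a; pose MC := map_mx toC M.
have [U unitU trigT] := Schur MC n_gt0.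
have UV := unitarymx_unit unitU.
have UM : U *m MC = conjmx U MC *m U by rewrite conjumx // mulmxKV.
have eigT := @eigenvalue_conjmx _ _ _ U MC _ _.
have diagT i : Re (conjmx U MC i i) < 0.
  apply: hurM; apply: eigT; rewrite ?stablemx_unit ?row_free_unit //.
  rewrite -topredE /= eigenvalue_root_char char_poly_trig //.
  by rewrite (bigD1 i) //= rootM root_XsubC eqxx.
set T := conjmx U MC in UM trigT diagT.
have [e e0 dissT] := trig_dissipative trigT diagT.
(* the real part of the weighted Hermitian form [U^* diag(e^(2k)) U] *)
pose P : 'M[R]_n := \matrix_(i, j)
  \sum_(k < n) e ^+ k.*2 * Re (Num.conj (U k i) * U k j).
have UvE (v : 'cV[R]_n) k : (U *m map_mx toC v) k 0 = \sum_i U k i * toC (v i 0).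
  by rewrite mxE; apply: eq_bigr => i _; rewrite mxE.
have bP u v : bform P u v = \sum_(k < n) e ^+ k.*2 *
    Re (Num.conj ((U *m map_mx toC u) k 0) * (U *m map_mx toC v) k 0).
  rewrite bformE; under eq_bigr do under eq_bigr do rewrite mxE mulr_suml.
  under eq_bigr do rewrite exchange_big.
  rewrite exchange_big /=; apply: eq_bigr => k _.
  rewrite !UvE rmorph_sum mulr_suml Re_sum mulr_sumr; apply: eq_bigr => i _.
  rewrite mulr_sumr Re_sum mulr_sumr; apply: eq_bigr => j _; rewrite rmorphM /=.
  by case: (U k i) => a b; case: (U k j) => x y /=; ring.
have Uv0 (v : 'cV[R]_n) : v != 0 -> U *m map_mx toC v != 0.
  apply: contra => /eqP/(congr1 (mulmx (invmx U))); rewrite mulKmx // mulmx0.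
  move/colP => v0; apply/eqP/colP => k; have := v0 k.
  by rewrite !mxE => -[].
have symP : P^T = P.
  apply/matrixP => i j; rewrite !mxE; apply: eq_bigr => k _.
  by case: (U k i) => a b; case: (U k j) => x y /=; ring.
exists P; split; [split=> // v v0|split=> [|v v0]].
- rewrite -[qform P v]/(bform P v v) bP.
  have h (k : 'I_n) : 0 <= e ^+ k.*2 * Re (Num.conj ((U *m map_mx toC v) k 0) * (U *m map_mx toC v) k 0).
    rewrite Re_conj_sqr.
    by rewrite mulr_ge0 ?sqr_ge0 ?exprn_ge0 // ltW.
  rewrite lt0r sumr_ge0 // andbT; apply: contra (Uv0 v v0).
  rewrite psumr_eq0 // => /allP v1; apply/eqP/colP => k; rewrite [RHS]mxE.
  apply: Normc.eq0_normc; apply/eqP; have := v1 k (mem_index_enum k).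
  rewrite /= Re_conj_sqr mulf_eq0 expf_eq0.
  by rewrite (gt_eqF e0) andbF sqrf_eq0.
- by rewrite linearN linearD /= !trmx_mul trmxK symP addrC.
rewrite -[qform _ v]/(bform _ v v) bform_mxN bform_mxD -bform_mull -bform_mulr.
rewrite oppr_gt0.
have -> : bform P (M *m v) v = bform P v (M *m v) by rewrite -bform_trmx symP.
suff : bform P v (M *m v) < 0 by lra.
rewrite bP; have := dissT _ (Uv0 v v0).
have -> : map_mx toC (M *m v) = MC *m map_mx toC v.
  exact: (map_mxM (real_complex R)).
by rewrite [U *m (MC *m _)]mulmxA UM -[T *m U *m _]mulmxA.
Qed.

End Lyapunov.

(** * The Riccati inequality *)

Lemma psd_lqr_gain (R : realType) n m (B : 'M[R]_(n, m)) (W : 'M[R]_m)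
    (P : 'M[R]_n) :
  P^T = P -> posdef W -> psd (P *m B *m invmx W *m B^T *m P).
Proof.
move=> symP posW; rewrite -[X in psd X]mulmxA.
have -> : B^T *m P = (P *m B)^T by rewrite trmx_mul symP.
rewrite -{1}[P *m B]trmxK.
exact/psd_congruence/psd_invmx.
Qed.

Lemma trmx_riccati (R : realType) n m (A : 'M[R]_n) (B : 'M[R]_(n, m)) Q W k l P :
  P^T = P -> Q^T = Q -> posdef W ->
  (riccati A B Q W k l P)^T = riccati A B Q W k l P.
Proof.
move=> symP symQ posW; have [symS _] := psd_lqr_gain B symP posW.
rewrite /riccati !linearD !linearZ /= symS symQ !trmx_mul trmxK symP.
by congr (_ + _ + _); rewrite addrC.
Qed.

(** With [P = t P0] and [kap = - k], the cross term [t (P0 B F + F^T B^T P0)] is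
    at least [- kap t^2 P0 B W^-1 B^T P0 - kap^-1 F^T W F].  The first summand is
    cancelled by the quadratic term of the Riccati expression, the second is
    independent of [t] and is dominated by the Lyapunov decrease of [t P0]. *)
Lemma riccati_inequality_solvable (R : realType) n m (A : 'M[R]_n)
    (B : 'M[R]_(n, m)) (Q : 'M[R]_n) (W : 'M[R]_m) (k l : R) :
  stabilizable A B -> Q^T = Q -> posdef W -> k < 0 ->
  exists P : 'M[R]_n, posdef P /\ negdef (riccati A B Q W k l P).
Proof.
move=> [F /hurwitz_lyapunov[P0 [posP0 posH]]] symQ posW k0.
have [symP0 P0_gt0] := posP0; set H := - _ in posH.
pose kap := - k; have kap0 : 0 < kap by rewrite oppr_gt0.
have [t0 t00 domH] := posdef_dominates (kap^-1 *: (F^T *m W *m F) + l *: Q) posH.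
(* one more than the dominating factor, for strictness *)
pose t := t0 + 1; have tgt0 : 0 < t by rewrite addr_gt0.
exists (t *: P0); have symP : (t *: P0)^T = t *: P0 by rewrite linearZ /= symP0.
split; [split=> // v v0|split=> [|v v0]].
- by rewrite qform_bform bform_mxZ mulr_gt0 //; exact: P0_gt0.
- by rewrite linearN /= trmx_riccati.
(* the square [Z^T W Z] absorbs the cross terms in [F] *)
pose Z := (kap * t) *: (invmx W *m B^T *m P0) + F.
have young : 0 <= qform (Z^T *m W *m Z) v.
  by have [_] := psd_congruence Z (posdef_psd posW); apply.
have {young} := young; have uW := posdef_unitmx posW.
have -> : Z^T *m W *m Z = (kap * t) ^+ 2 *: (P0 *m B *m invmx W *m B^T *m P0)
    + (kap * t) *: (P0 *m (B *m F) + (B *m F)^T *m P0) + F^T *m W *m F.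
  have -> : Z^T = (kap * t) *: (P0 *m B *m invmx W) + F^T.
    by rewrite [LHS]linearD linearZ /= !trmx_mul trmx_inv trmxK symP0 (posW.1) mulmxA.
  rewrite mulmxDl mulmxDr !mulmxDl -!(scalemxAl, scalemxAr) scalerA expr2.
  rewrite trmx_mul !mulmxA mulmxKV // -[F^T *m W *m invmx W]mulmxA mulmxV //.
  rewrite mulmx1 scalerDr !addrA; congr (_ + _); rewrite -!addrA; congr (_ + _).
  exact: addrC.
have -> : riccati A B Q W k l (t *: P0) = - (t *: (H + (P0 *m (B *m F) + (B *m F)^T *m P0)))
   - (kap * t ^+ 2) *: (P0 *m B *m invmx W *m B^T *m P0) + l *: Q.
  rewrite /riccati /H /kap -!(scalemxAl, scalemxAr) !scalerA.
  rewrite -scalerDr -scalerN opprD opprK.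
  congr (_ + _ + _); last by rewrite mulNr scaleNr opprK expr2 ?mulrA.
  congr (_ *: _); rewrite linearD /= mulmxDl mulmxDr.
  by rewrite addrACA [X in _ - X]addrC addrK.
clearbody H; rewrite !qform_bform; have := domH v; rewrite !qform_bform.
have := posH.2 v v0; rewrite qform_bform.
rewrite !(bform_mxD, bform_mxN, bform_mxZ).
set h := bform H v v; set f := bform (F^T *m W *m F) v v; set q := bform Q v v.
set s := bform (P0 *m B *m invmx W *m B^T *m P0) v v.
set x := bform (P0 *m (B *m F)) v v; set y := bform ((B *m F)^T *m P0) v v.
move=> h0 dom young.
have : 0 <= kap^-1 * ((kap * t) ^+ 2 * s + kap * t * (x + y) + f).
  by rewrite mulr_ge0 ?invr_ge0 ?(ltW kap0).
have -> : kap^-1 * ((kap * t) ^+ 2 * s + kap * t * (x + y) + f) =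
    kap * t ^+ 2 * s + t * (x + y) + kap^-1 * f by field; rewrite gt_eqF.
have : t * h = t0 * h + h by rewrite /t; ring.
lra.
Qed.

(** * The Laplacian with leader gains *)

Lemma grounded_laplacianE (R : realType) N (a : 'M[R]_N) (g : 'I_N -> R) i j :
  (laplacian a + diag_mx (\row_k g k)) i j =
  (i == j)%:R * (\sum_k a i k + g i) - a i j.
Proof.
rewrite !mxE; case: eqVneq => [->|_]; rewrite ?mulr1n ?mulr0n; ring.
Qed.

Lemma trmx_grounded_laplacian (R : realType) N (a : 'M[R]_N) (g : 'I_N -> R) :
  a^T = a ->
  (laplacian a + diag_mx (\row_i g i))^T = laplacian a + diag_mx (\row_i g i).
Proof. by move=> syma; rewrite /laplacian !linearD linearN /= !tr_diag_mx syma. Qed.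

Lemma laplacian_qform (R : realType) n N (a : 'M[R]_N) (g : 'I_N -> R) (Q : 'M[R]_n)
    (z : 'I_N -> 'cV[R]_n) : a^T = a -> Q^T = Q ->
  \sum_i \sum_j (laplacian a + diag_mx (\row_k g k)) i j * bform Q (z i) (z j) =
  2^-1 * (\sum_i \sum_j a i j * qform Q (z i - z j)) + \sum_i g i * qform Q (z i).
Proof.
move=> syma symQ.
have qB u v : qform Q (u - v) = qform Q u + qform Q v - 2 * bform Q u v.
  rewrite !qform_bform -scaleN1r !(bformDl, bformDr, bformZl, bformZr).
  by rewrite -[bform Q v u]bform_trmx symQ; ring.
transitivity (\sum_i ((\sum_k a i k + g i) * qform Q (z i)) -
    \sum_i \sum_j a i j * bform Q (z i) (z j)).
  rewrite -sumrB; apply: eq_bigr => i _.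
  under eq_bigr do rewrite grounded_laplacianE mulrBl.
  rewrite sumrB; congr (_ - _); set d := _ + _.
  rewrite (bigD1 i) //= eqxx mul1r.
  by rewrite big1 ?addr0 // => j /negPf ji; rewrite eq_sym ji !mul0r.
have swap : \sum_i \sum_j a i j * qform Q (z j) = \sum_i \sum_j a i j * qform Q (z i).
  rewrite exchange_big; apply: eq_bigr => i _; apply: eq_bigr => j _ /=.
  by rewrite -[in LHS]syma mxE.
have -> : \sum_i \sum_j a i j * qform Q (z i - z j) =
    2 * (\sum_i \sum_j a i j * qform Q (z i))
    - 2 * (\sum_i \sum_j a i j * bform Q (z i) (z j)).
  rewrite [in X in X - _]mulr2n mulrDl mul1r -{2}swap -big_split mulr_sumr -sumrB.
  apply: eq_bigr => i _; rewrite -big_split mulr_sumr -sumrB /=.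
  by apply: eq_bigr => j _; rewrite qB; ring.
have -> : \sum_i (\sum_k a i k + g i) * qform Q (z i) =
    \sum_i \sum_j a i j * qform Q (z i) + \sum_i g i * qform Q (z i).
  by rewrite -big_split; apply: eq_bigr => i _ /=; rewrite mulrDl mulr_suml.
lra.
Qed.

Lemma trmx_adjacency (R : realType) N (e : rel 'I_N) :
  symmetric e -> (adjacency R e)^T = adjacency R e.
Proof. by move=> syme; apply/matrixP => i j; rewrite !mxE syme. Qed.

(** If the form vanishes at [v], then [v] is constant along edges, hence
    constant by connectedness, and it is zero at a node that receives the leader's
    state. *)
Lemma grounded_laplacian_posdef (R : realType) N (e : rel 'I_N) (g : 'I_N -> R) :
  simple_connected_graph e -> (forall i, 0 <= g i) -> (exists i, 0 < g i) ->
  posdef (laplacian (adjacency R e) + diag_mx (\row_i g i)).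
Proof.
set G := _ + _; move=> [syme _ conn_e] g0 [i0 gi0].
have syma := trmx_adjacency R syme.
split=> [|v v0]; first exact: trmx_grounded_laplacian.
have tr1 : (1%:M : 'M[R]_1)^T = 1%:M by rewrite tr_scalar_mx.
have := laplacian_qform g (fun i => (v i 0)%:M) syma tr1.
rewrite -/G.
have -> : \sum_i \sum_j G i j * bform 1%:M (v i 0)%:M (v j 0)%:M = qform G v.
  rewrite qform_bform bformE; apply: eq_bigr => i _; apply: eq_bigr => j _.
  by congr (_ * _); rewrite /bform mulmx1 tr_scalar_mx -scalar_mxM mxE eqxx mulr1n.
have q1 (x : R) : qform 1%:M x%:M = x ^+ 2.
  by rewrite qform1 big_ord1 mxE eqxx mulr1n.
under eq_bigr do under eq_bigr do rewrite -raddfB q1.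
under [X in _ = _ + X]eq_bigr do rewrite q1.
set S1 := \sum_i \sum_j _; set S2 := \sum_i _ => ->.
have t1 i j : 0 <= adjacency R e i j * (v i 0 - v j 0) ^+ 2.
  by rewrite mxE mulr_ge0 ?sqr_ge0 ?ler0n.
have t2 i : 0 <= g i * v i 0 ^+ 2 by rewrite mulr_ge0 ?sqr_ge0.
have S10 : 0 <= S1 by do 2! rewrite sumr_ge0 // => ? _.
have S20 : 0 <= S2 by rewrite sumr_ge0.
rewrite ltNge; apply/negP => le0; case/negP: v0.
have S1E : S1 = 0 by lra.
have S2E : S2 = 0 by lra.
have edge i j : e i j -> v i 0 = v j 0.
  move=> eij; move/eqP: S1E; rewrite psumr_eq0 => [/allP/(_ i (mem_index_enum i))|k _]; last first.
    by rewrite sumr_ge0.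
  rewrite /= psumr_eq0 => [/allP/(_ j (mem_index_enum j))|//].
  by rewrite /= mxE eij mul1r sqrf_eq0 subr_eq0 => /eqP.
have vi0 : v i0 0 = 0.
  move/eqP: S2E; rewrite psumr_eq0 // => /allP/(_ i0 (mem_index_enum i0)).
  by rewrite /= mulf_eq0 (gt_eqF gi0) sqrf_eq0 => /eqP.
apply/eqP/colP => i; rewrite mxE -vi0; case/connectP: (conn_e i i0) => p; elim: p i => [|j p IH] i /=; first by move=> _ ->.
by case/andP => /edge -> pth lst; exact: IH.
Qed.

Lemma ordered_spectrum_bounds (R : realType) N (M : 'M[R]_N) (lam : N.-tuple R) d :
  ordered_spectrum M lam -> eigenvalue M d -> lam`_0 <= d <= lam`_N.-1.
Proof.
move=> [sorted_lam charM]; rewrite eigenvalue_root_char charM root_prod_XsubC.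
case/(nthP 0) => i; rewrite size_tuple => iN <-.
have N0 : (0 < N)%N by exact: leq_ltn_trans iN.
have le_nth := sorted_leq_nth (@le_trans _ R) (@lexx _ R) 0 sorted_lam.
apply/andP; split; apply: le_nth; rewrite ?inE ?size_tuple ?prednK //.
by rewrite -ltnS prednK.
Qed.

Lemma ordered_spectrum_eigenvalue (R : realType) N (M : 'M[R]_N) (lam : N.-tuple R) i :
  ordered_spectrum M lam -> (i < N)%N -> eigenvalue M lam`_i.
Proof.
move=> [_ charM] iN; rewrite eigenvalue_root_char charM root_prod_XsubC.
by rewrite mem_nth ?size_tuple.
Qed.

(** * Dissipation of the closed loop *)

(** The left-hand side is the derivative of [sum_i z_i^T P z_i] along the closed
    loop plus the cost density.  It equals the form of
    [1 (x) M0 + G (x) M1 + G^2 (x) M2], whose block at the eigenvalue [d] is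
    below the Riccati expression since both [S] and [Q] are semidefinite. *)
Lemma closed_loop_dissipation (R : realType) n m N (A : 'M[R]_n) (B : 'M[R]_(n, m))
    (Q : 'M[R]_n) (W : 'M[R]_m) (P : 'M[R]_n) (G : 'M[R]_N) (c k l : R)
    (K := (- c) *: (invmx W *m B^T *m P)) (z : 'I_N -> 'cV[R]_n)
    (u := fun i => \sum_j G i j *: (K *m z j)) :
  psd Q -> posdef W -> P^T = P -> G^T = G ->
  (forall d, eigenvalue G d -> c ^+ 2 * d ^+ 2 - 2 * c * d <= k /\ d <= l) ->
  \sum_i 2 * bform P (z i) (A *m z i + B *m u i)
    + \sum_i \sum_j G i j * bform Q (z i) (z j) + \sum_i qform W (u i)
  <= \sum_i qform (riccati A B Q W k l P) (z i).
Proof.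
move=> [symQ Q0] posW symP symG specG; have uW := posdef_unitmx posW.
pose S := P *m B *m invmx W *m B^T *m P.
have [symS S0] : psd S := psd_lqr_gain B symP posW.
pose M0 := A^T *m P + P *m A; pose M1 := Q - (2 * c) *: S; pose M2 := c ^+ 2 *: S.
have PBK : P *m (B *m K) = (- c) *: S.
  by rewrite /K -!scalemxAr !mulmxA.
have KWK : K^T *m W *m K = M2.
  have -> : K^T = (- c) *: (P *m B *m invmx W).
    by rewrite [LHS]linearZ /= !trmx_mul trmx_inv trmxK symP (posW.1) mulmxA.
  by rewrite -!(scalemxAl, scalemxAr) scalerA mulrNN -expr2 !mulmxA mulmxKV.
have E1 i : 2 * bform P (z i) (A *m z i + B *m u i) =
    qform M0 (z i) + \sum_j G i j * bform (- (2 * c) *: S) (z i) (z j).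
  rewrite bformDr mulrDr; congr (_ + _).
    rewrite /M0 qform_bform bform_mxD -bform_mull -bform_mulr.
    by rewrite -[bform P (A *m _) _]bform_trmx symP; ring.
  rewrite /u mulmx_sumr bform_sumr mulr_sumr; apply: eq_bigr => j _.
  rewrite -scalemxAr bformZr bform_mulr bform_mulr -mulmxA PBK !bform_mxZ; ring.
have E2 : \sum_i qform W (u i) = \sum_i \sum_j (G *m G) i j * bform M2 (z i) (z j).
  transitivity (\sum_h \sum_i \sum_j G h i * G h j * bform M2 (z i) (z j)).
    apply: eq_bigr => h _; rewrite qform_bform bform_suml; apply: eq_bigr => i _.
    rewrite bform_sumr; apply: eq_bigr => j _.
    by rewrite bformZl bformZr bform_mull bform_mulr KWK mulrA.
  rewrite exchange_big; apply: eq_bigr => i _.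
  rewrite exchange_big; apply: eq_bigr => j _.
  by rewrite mxE mulr_suml; apply: eq_bigr => h _; rewrite -[in LHS]symG mxE symG.
apply: le_trans (kron_polynomial_le (M0 := M0) (M1 := M1) (M2 := M2) symG _ z); last first.
  move=> d /specG[dk dl] v; rewrite /riccati -/S -/M0 !qform_bform.
  rewrite /M1 /M2 !(bform_mxD, bform_mxN, bform_mxZ).
  have s0 : 0 <= bform S v v := S0 v; have q0 : 0 <= bform Q v v := Q0 v.
  have h1 := ler_wpM2r s0 dk; have h2 := ler_wpM2r q0 dl.
  by nra.
rewrite E2 lerD2r (eq_bigr _ (fun i _ => E1 i)) big_split /= -addrA lerD2l.
rewrite -big_split ler_sum // => i _; rewrite -big_split ler_sum //= => j _.
by rewrite /M1 bform_mxD scaleNr; lra.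
Qed.

(** * Continuity and derivatives of forms along trajectories *)

Section Continuity.
Variable R : realType.

Lemma cvg_col (T : Type) (F : set_system T) (FF : Filter F) n
    (u : T -> 'cV[R]_n) (l : 'cV[R]_n) :
  (forall k, u t k 0 @[t --> F] --> l k 0) -> u t @[t --> F] --> l.
Proof.
move=> ul; apply/cvgrPdist_le => /= eps eps0; near=> t.
rewrite /Num.Def.normr/= mx_normrE (bigmax_le _ (ltW eps0))//= => -[i j] _.
rewrite /= !mxE (ord1 j); move: i; near: t; apply: filter_forall => /= i.
exact: ((cvgrPdist_le _ _).1 (ul i)).
Unshelve. all: by end_near. Qed.

Lemma continuous_sum (T : topologicalType) (V : normedModType R) I (s : seq I)
    (f : I -> T -> V) :
  (forall i, continuous (f i)) -> continuous (fun t => \sum_(i <- s) f i t).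
Proof.
move=> cf; elim: s => [|i s IH].
  by under eq_fun do rewrite big_nil; exact: cst_continuous.
under eq_fun do rewrite big_cons.
by move=> t; apply: cvgD; [exact: cf|exact: IH].
Qed.

Lemma continuous_coord (T : topologicalType) n (u : T -> 'cV[R]_n) k :
  continuous u -> continuous (fun t => u t k 0).
Proof.
move=> cu t; apply: (@continuous_comp _ _ _ u (fun v => v k 0)); first exact: cu.
exact: (@coord_continuous R n 1 k 0 (u t)).
Qed.

Lemma continuous_bform (T : topologicalType) n m (M : 'M[R]_(n, m))
    (u : T -> 'cV[R]_n) (v : T -> 'cV[R]_m) :
  continuous u -> continuous v -> continuous (fun t => bform M (u t) (v t)).
Proof.
move=> cu cv; under eq_fun do rewrite bformE.
apply: continuous_sum => i; apply: continuous_sum => j t.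
apply: cvgM; first exact: cvg_cst.
by apply: cvgM; exact: continuous_coord.
Qed.

Lemma continuous_mulmx (T : topologicalType) n m (M : 'M[R]_(n, m))
    (u : T -> 'cV[R]_m) : continuous u -> continuous (fun t => M *m u t).
Proof.
move=> cu t; apply: cvg_col => k; under eq_fun do rewrite mxE; rewrite mxE.
apply: (@continuous_sum T R^o _ _ (fun j t => M k j * u t j 0)) => j s.
by apply: cvgM; [exact: cvg_cst|exact: continuous_coord].
Qed.

End Continuity.

Section Derivative.
Variable R : realType.

Lemma is_derive_coord n (z : R -> 'cV[R]_n) (dz : 'cV[R]_n) (t : R) (k : 'I_n) :
  is_derive t 1 z dz -> is_derive t 1 (fun s => z s k 0) (dz k 0).
Proof.
move=> [dvz dzE]; apply: DeriveDef; first exact: (derivable_mxP z t 1).1.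
by rewrite -dzE derive_mx // mxE.
Qed.

Lemma is_derive_bform n m (M : 'M[R]_(n, m)) (u : R -> 'cV[R]_n)
    (v : R -> 'cV[R]_m) du dv (t : R) :
  is_derive t 1 u du -> is_derive t 1 v dv ->
  is_derive t 1 (fun s => bform M (u s) (v s)) (bform M du (v t) + bform M (u t) dv).
Proof.
move=> /is_derive_coord cu /is_derive_coord cv.
have -> : (fun s => bform M (u s) (v s)) =
    \sum_i \sum_j (M i j *: ((fun s => u s i 0) * (fun s => v s j 0))).
  apply/funext => s; rewrite bformE fct_sumE; apply: eq_bigr => i _.
  by rewrite fct_sumE.
have -> : bform M du (v t) + bform M (u t) dv =
    \sum_i \sum_j (M i j *: (u t i 0 *: dv j 0 + v t j 0 *: du i 0)).
  rewrite !bformE -big_split; apply: eq_bigr => i _ /=.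
  rewrite -big_split; apply: eq_bigr => j _ /=.
  by rewrite /GRing.scale /=; ring.
apply: is_derive_sum => i; apply: is_derive_sum => j.
apply: is_deriveZ; exact: is_deriveM.
Qed.

End Derivative.

(** * Energy estimate *)

(** Multiplied by [1 + d t], [V] is still nonincreasing, which already forces [V]
    to tend to 0.  Then the fundamental theorem of calculus gives
    [V(0)] for the integral of [- dV], which dominates [f]. *)
Lemma lyapunov_cost_bound (R : realType) (V dV f : R -> R) (d : R) :
  0 < d ->
  {within `[0, +oo[, continuous V} -> {within `[0, +oo[, continuous dV} ->
  {within `[0, +oo[, continuous f} ->
  (forall t : R, 0 < t -> is_derive t 1 V (dV t)) ->
  (forall t, 0 <= V t) -> (forall t, 0 <= f t) ->
  (forall t, f t + d * V t <= - dV t) ->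
  V t @[t --> +oo] --> 0 /\
  (\int[@lebesgue_measure R]_(t in `[0%R, +oo[) (f t)%:E <= (V 0)%:E)%E.
Proof.
move=> d0 cV cdV cf derV V0 f0 dissV.
have bound t : 0 <= t -> (1 + d * t) * V t <= V 0.
  move=> t0; pose w s := (1 + d * s) * V s.
  have w_der (s : R) : 0 < s -> is_derive s 1 w (dV s * (1 + d * s) + d * V s).
    move=> s0; have Vs := derV s s0.
    have lin : is_derive s 1 (fun x : R => 1 + d * x) d.
      have := is_deriveD (is_derive_cst (1 : R) s (1 : R))
        (is_deriveZ d (is_derive_id s (1 : R))).
      by rewrite add0r /GRing.scale /= mulr1.
    apply: (is_derive_eq (is_deriveM lin Vs)).
    by rewrite /GRing.scale /=; ring.
  have w0 : w 0 = V 0 by rewrite /w mulr0 addr0 mul1r.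
  rewrite -w0; apply: (@ler0_derive1_nincry R w 0) => //.
  - by move=> s; rewrite in_itv /= andbT => /w_der[].
  - move=> s; rewrite in_itv /= andbT => s0.
    rewrite derive1E; have [_ ->] := w_der s s0.
    have ds0 : 0 <= d * s by rewrite mulr_ge0 ?ltW.
    have dV0 : 0 <= d * V s by rewrite mulr_ge0 // ltW.
    have h1 : 0 <= (- dV s - d * V s) * (1 + d * s).
      apply: mulr_ge0; last exact: addr_ge0.
      by have := dissV s; have := f0 s; lra.
    have h2 : 0 <= (d * V s) * (d * s) by rewrite mulr_ge0.
    move: h1 h2; lra.
  - move=> s; apply: cvgM; last exact: cV.
    apply: cvgD; first exact: cvg_cst.
    apply: cvgM; first exact: cvg_cst.
    move: s; apply: continuous_subspaceT => s; exact: cvg_id.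
have V_lim : V t @[t --> +oo] --> 0.
  apply/cvgrPdist_le => /= eps eps0; near=> t.
  have t0 : 0 <= t by near: t; exact: nbhs_pinfty_ge.
  rewrite sub0r normrN ger0_norm //.
  have tV : V 0 / (d * eps) <= t by near: t; apply: nbhs_pinfty_ge; exact: num_real.
  rewrite ler_pdivrMr ?mulr_gt0 // in tV.
  have := bound t t0; have := V0 t; have dt0 : 0 <= d * t by rewrite mulr_ge0 // ltW.
  move=> Vt0 bt; rewrite leNgt; apply/negP => epsV.
  have : (1 + d * t) * eps < (1 + d * t) * V t by rewrite ltr_pM2l // ltr_pwDl.
  by nra.
split=> //.
have cNdV : {within `[0, +oo[, continuous (- dV)}.
  by move=> t; apply: cvgN; exact: cdV.
have f_le t : f t <= - dV t.
  have : 0 <= d * V t by rewrite mulr_ge0 // ltW.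
  by have := dissV t; lra.
have FTC : (\int[@lebesgue_measure R]_(t in `[0%R, +oo[) ((- dV) t)%:E =
    (- 0)%:E - ((- V) 0)%:E)%E.
  apply: ge0_continuous_FTC2y => //.
  - by move=> t _; rewrite (le_trans (f0 t)).
  - exact: cvgN.
  - by move=> t t0; apply: derivableN; have [] := derV t t0.
  - by apply: cvgN; have /continuous_within_itvcyP[] := cV.
  - move=> t; rewrite in_itv /= andbT => t0; have Vt := derV t t0.
    rewrite derive1E; exact: derive_val.
have -> : V 0 = - 0 - (- V) 0 by rewrite oppr0 sub0r opprK.
rewrite EFinB -FTC; apply: ge0_le_integral => //.
- by move=> t _; rewrite lee_fin.
- by apply/measurable_EFinP; exact: subspace_continuous_measurable_fun.
- by apply/measurable_EFinP; exact: subspace_continuous_measurable_fun.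
- by move=> t _; rewrite lee_fin.
Unshelve. all: by end_near. Qed.

(** * Consensus and cost of the closed loop *)

Section ClosedLoop.
Variables (R : realType) (n m N : nat).
Variables (A : 'M[R]_n) (B : 'M[R]_(n, m)) (Q : 'M[R]_n) (W : 'M[R]_m).
Variables (a : 'M[R]_N) (g : 'I_N -> R).
Let G : 'M[R]_N := laplacian a + diag_mx (\row_i g i).

Lemma control_law_errors (K : 'M[R]_(m, n)) xr (x : 'I_N -> R -> 'cV[R]_n) i t :
  control_law a g K xr x i t = \sum_j G i j *: (K *m (x j t - xr t)).
Proof.
rewrite /control_law -mulmxDr.
under [in RHS]eq_bigr do rewrite scalemxAr.
rewrite -mulmx_sumr; congr (_ *m _).
under [in RHS]eq_bigr do rewrite grounded_laplacianE scalerBl.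
rewrite sumrB; set d := _ + _; rewrite [in RHS](bigD1 i) //= eqxx mul1r.
rewrite [X in _ + X - _]big1 ?addr0 => [|j /negPf ji]; last first.
  by rewrite eq_sym ji mul0r scale0r.
rewrite scalerDl scaler_suml addrAC -sumrB; congr (_ + _).
by apply: eq_bigr => j _; rewrite -scalerBr opprB addrA subrK.
Qed.

Hypotheses (a0 : forall i j, 0 <= a i j) (syma : a^T = a).
Hypotheses (g0 : forall i, 0 <= g i) (psdQ : psd Q) (posW : posdef W).
Variables (P : 'M[R]_n) (c k l : R).
Hypotheses (posP : posdef P) (ricP : negdef (riccati A B Q W k l P)).
Hypothesis specG :
  forall d, eigenvalue G d -> c ^+ 2 * d ^+ 2 - 2 * c * d <= k /\ d <= l.
Let K : 'M[R]_(m, n) := (- c) *: (invmx W *m B^T *m P).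

(** Energy and cost are controlled together: since the Riccati expression is
    negative definite, it lies below [- T^-1 P] for some [T > 0], and the
    dissipation inequality becomes the hypothesis of
    [lyapunov_cost_bound] with rate [T^-1]. *)
Lemma closed_loop_lyapunov xr (x : 'I_N -> R -> 'cV[R]_n) :
  closed_loop A B a g K xr x ->
  \sum_i qform P (x i t - xr t) @[t --> +oo] --> (0 : R) /\
  (cost_gain Q W a g K xr x <= (\sum_i qform P (x i 0 - xr 0))%:E)%E.
Proof.
move=> [[cxr dxr] solx].
have symP := posP.1; have [symQ Q0] := psdQ; have [_ W0] := posdef_psd posW.
have symG : G^T = G by exact: trmx_grounded_laplacian.
pose e i t := x i t - xr t; pose u i t := \sum_j G i j *: (K *m e j t).
have ce i : {within `[0, +oo[, continuous (e i)}.
  by move=> t; apply: cvgB; [exact: (solx i).1|exact: cxr].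
have cu i : {within `[0, +oo[, continuous (u i)}.
  apply: continuous_sum => j t; apply: cvgZr.
  exact: (continuous_mulmx (ce j)).
have de i (t : R) : 0 < t -> is_derive t 1 (e i) (A *m e i t + B *m u i t).
  move=> t0; apply: (is_derive_eq (is_deriveB ((solx i).2 t t0) (dxr t t0))).
  by rewrite control_law_errors /e mulmxBr addrAC.
pose V t := \sum_i bform P (e i t) (e i t).
pose dV t := \sum_i 2 * bform P (e i t) (A *m e i t + B *m u i t).
pose f t := 2^-1 * (\sum_i \sum_j a i j * qform Q (x i t - x j t))
  + \sum_i g i * qform Q (x i t - xr t)
  + \sum_i qform W (control_law a g K xr x i t).
have fE t : f t = \sum_i \sum_j G i j * bform Q (e i t) (e j t)
    + \sum_i bform W (u i t) (u i t).
  rewrite /G laplacian_qform //; congr (_ + _ + _).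
    congr (_ * _); apply: eq_bigr => i _; apply: eq_bigr => j _.
    by rewrite /e opprB addrA subrK.
  by apply: eq_bigr => i _; rewrite control_law_errors.
have [T T0 domP] := posdef_dominates P ricP.
apply: (@lyapunov_cost_bound R V dV f T^-1).
- by rewrite invr_gt0.
- by apply: continuous_sum => i; exact: continuous_bform (ce i) (ce i).
- apply: continuous_sum => i t; apply: cvgM; first exact: cvg_cst.
  apply: (continuous_bform (ce i)) => s; apply: cvgD.
    exact: (continuous_mulmx (ce i)).
  exact: (continuous_mulmx (cu i)).
- rewrite (funext fE).
  move=> t; apply: cvgD; apply: continuous_sum => i.
    apply: continuous_sum => j s; apply: cvgM; first exact: cvg_cst.
    exact: (continuous_bform (ce i) (ce j)).
  exact: (continuous_bform (cu i) (cu i)).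
- move=> t t0; rewrite (_ : V = \sum_i (fun s => bform P (e i s) (e i s))).
    apply: is_derive_sum => i; have di := de i t t0.
    apply: (is_derive_eq (is_derive_bform P di di)).
    by rewrite -[X in X + _]bform_trmx symP mulr2n mulrDl mul1r.
  by apply/funext => s; rewrite fct_sumE.
- by move=> t; apply: sumr_ge0 => i _; exact: (posdef_psd posP).2.
- move=> t; rewrite !addr_ge0 ?mulr_ge0 ?invr_ge0 ?ler0n ?sumr_ge0 // => i _.
  + by apply: sumr_ge0 => j _; rewrite mulr_ge0.
  + by rewrite mulr_ge0.
move=> t; have := closed_loop_dissipation A B (fun i => e i t) psdQ posW symP symG specG.
rewrite -/K -[\sum_i 2 * _]/(dV t) fE => diss.
suff : T^-1 * V t <= - \sum_i qform (riccati A B Q W k l P) (e i t).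
  by move: diss; rewrite /u; lra.
rewrite mulr_sumr -sumrN ler_sum // => i _.
rewrite mulrC ler_pdivrMr // mulrC qform_bform -bform_mxN.
exact: domP.
Qed.

(** The energy dominates each squared coordinate of each error. *)
Lemma closed_loop_tracking : tracking_consensus A B a g K.
Proof.
move=> xr0 x0 xr x _ _ /closed_loop_lyapunov[V_lim _] i.
have [T T0 domP] := posdef_dominates 1%:M posP.
apply: cvg_col => k'; rewrite [X in _ --> X]mxE.
apply/cvgrPdist_le => /= eps eps0; near=> t.
rewrite sub0r normrN -(@ler_pXn2r _ 2) ?nnegrE ?(ltW eps0) // real_normK ?num_real //.
have Vt : `|0 - \sum_i qform P (x i t - xr t)| <= eps ^+ 2 / T.
  near: t; apply: (cvgrPdist_le _ _).1 V_lim _ _.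
  by rewrite divr_gt0 // exprn_gt0.
have qP j : 0 <= qform P (x j t - xr t) by exact: (posdef_psd posP).2.
rewrite sub0r normrN ger0_norm ?sumr_ge0 // ler_pdivlMr // in Vt.
apply: le_trans Vt; rewrite mulrC.
apply: (@le_trans _ _ (T * qform P (x i t - xr t))); last first.
  by rewrite ler_pM2l // (bigD1 i) //= lerDl sumr_ge0.
apply: le_trans (domP _); rewrite qform1 (bigD1 k') //= lerDl.
by rewrite sumr_ge0 // => j _; exact: sqr_ge0.
Unshelve. all: by end_near. Qed.

Lemma enorm_stack (x0 : 'I_N -> 'cV[R]_n) (xr0 : 'cV[R]_n) :
  enorm (stack x0 - (const_mx 1 : 'cV[R]_N) *t xr0) ^+ 2 =
  \sum_i qform 1%:M (x0 i - xr0).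
Proof.
rewrite /enorm sqr_sqrtr; last by rewrite sumr_ge0 // => j _; exact: sqr_ge0.
under [in RHS]eq_bigr do rewrite qform1.
rewrite pair_big /= (reindex (@mxtens_index N n)) /=; last first.
  by exists (@mxtens_unindex N n) => j _; rewrite ?mxtens_indexK ?mxtens_unindexK.
apply: eq_bigr => -[i j] _; rewrite !mxE mxtens_indexK /= mul1r.
by rewrite [(Ordinal _)]ord1.
Qed.

(** Definiteness of [gamma / r^2 - P] is used in the coercive form
    [P <= gamma / r^2 - d], which gives a strict bound on [V(0)] unless all initial
    errors vanish; in that case [V(0) = 0 < gamma]. *)
Lemma closed_loop_guaranteed_cost (r gamma : R) : 0 < r -> 0 < gamma ->
  posdef ((gamma / r ^+ 2)%:M - P) -> guaranteed_cost A B Q W a g K r gamma.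
Proof.
move=> r0 gamma0 /posdef_coercive[d d0 coerP] xr0 x0 xr x xrE xE.
move=> /closed_loop_lyapunov[_ costV] ball; apply: le_lt_trans costV _.
rewrite lte_fin xrE; under eq_bigr do rewrite xE.
set s := \sum_i qform 1%:M (x0 i - xr0).
have s_le : s <= r ^+ 2.
  rewrite /s -enorm_stack ler_pXn2r // nnegrE ?(ltW r0) //; exact: sqrtr_ge0.
have s0 : 0 <= s by apply: sumr_ge0 => i _; exact: qform1_ge0.
set V0 := \sum_i _.
have V0_le : V0 <= (gamma / r ^+ 2 - d) * s.
  rewrite mulr_sumr ler_sum // => i _; have := coerP (x0 i - xr0).
  by rewrite !qform_bform -[(gamma / _)%:M]scalemx1 bform_mxD bform_mxN bform_mxZ mulrBl; lra.
have r2 : 0 < r ^+ 2 by rewrite exprn_gt0.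
have scaled : gamma / r ^+ 2 * s <= gamma.
  by rewrite mulrAC ler_pdivrMr // ler_pM2l.
have [s_gt0|] := ltrP 0 s.
  have : 0 < d * s by exact: mulr_gt0.
  by move: V0_le; rewrite mulrBl; lra.
move=> s_le0; have s00 : s = 0 by apply/eqP; rewrite eq_le s_le0.
by rewrite (le_lt_trans V0_le) // s00 mulr0.
Qed.

End ClosedLoop.

(** Both cases of the theorem, with [k] the maximum of [c^2 d^2 - 2 c d] over the
    spectrum. *)
Lemma distributed_riccati_control (R : realType) n m N (A : 'M[R]_n)
    (B : 'M[R]_(n, m)) (Q : 'M[R]_n) (W : 'M[R]_m) (a : 'M[R]_N) (g : 'I_N -> R)
    (r gamma c k l : R) :
  stabilizable A B -> psd Q -> posdef W ->
  (forall i j, 0 <= a i j) -> a^T = a -> (forall i, 0 <= g i) ->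
  0 < r -> 0 < gamma -> k < 0 ->
  (forall d, eigenvalue (laplacian a + diag_mx (\row_i g i)) d ->
     c ^+ 2 * d ^+ 2 - 2 * c * d <= k /\ d <= l) ->
  (exists P : 'M[R]_n, posdef P /\ negdef (riccati A B Q W k l P)) /\
  (forall P : 'M[R]_n, posdef P -> negdef (riccati A B Q W k l P) ->
     posdef ((gamma / r ^+ 2)%:M - P) ->
     let K := (- c) *: (invmx W *m B^T *m P) in
     tracking_consensus A B a g K /\ guaranteed_cost A B Q W a g K r gamma).
Proof.
move=> stabAB psdQ posW a0 syma g0 r0 gamma0 k0 specG; split.
  exact: riccati_inequality_solvable stabAB psdQ.1 posW k0.
move=> P posP ricP boundP K; split.
  exact: (@closed_loop_tracking _ _ _ _ _ _ _ _ _ _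
    a0 syma g0 psdQ posW _ _ _ _ posP ricP specG).
exact: (@closed_loop_guaranteed_cost _ _ _ _ _ _ _ _ _ _
  a0 syma g0 psdQ posW _ _ _ _ posP ricP specG _ _ r0 gamma0 boundP).
Qed.

Theorem theorem9 (R : realType) (n m N : nat)
    (A : 'M[R]_n) (B : 'M[R]_(n, m)) (Q : 'M[R]_n) (W : 'M[R]_m)
    (e : rel 'I_N) (g : 'I_N -> R) (lam : N.-tuple R) (r gamma c : R)
    (hAB : stabilizable A B) (hQ : psd Q) (hW : posdef W)
    (he : simple_connected_graph e)
    (hg : forall i, 0 <= g i) (hg_pos : exists i, 0 < g i)
    (hlam : ordered_spectrum
              (laplacian (adjacency R e) + diag_mx (\row_i g i)) lam)
    (hr : 0 < r) (hgamma : 0 < gamma)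
    (hc_pos : 0 < c) (hc_lt : c < 2 / lam`_N.-1) :
  let a := adjacency R e in
  let l1 := lam`_0 in
  let lN := lam`_N.-1 in
  let achieves (P : 'M[R]_n) :=
    let K := (- c) *: (invmx W *m B^T *m P) in
    tracking_consensus A B a g K /\ guaranteed_cost A B Q W a g K r gamma in
  (2 / (l1 + lN) <= c ->
     let ineq (P : 'M[R]_n) :=
       negdef (riccati A B Q W (c ^+ 2 * lN ^+ 2 - 2 * c * lN) lN P) in
     (exists P : 'M[R]_n, posdef P /\ ineq P) /\
     (forall P : 'M[R]_n, posdef P -> ineq P ->
        posdef ((gamma / r ^+ 2)%:M - P) -> achieves P))
  /\
  (c < 2 / (l1 + lN) ->
     let ineq (P : 'M[R]_n) :=
       negdef (riccati A B Q W (c ^+ 2 * l1 ^+ 2 - 2 * c * l1) lN P) in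
     (exists P : 'M[R]_n, posdef P /\ ineq P) /\
     (forall P : 'M[R]_n, posdef P -> ineq P ->
        posdef ((gamma / r ^+ 2)%:M - P) -> achieves P)).
Proof.
move=> a l1 lN achieves.
have posG := grounded_laplacian_posdef he hg hg_pos.
have N0 : (0 < N)%N by have [i _] := hg_pos; exact: leq_ltn_trans (ltn_ord i).
have eig1 : eigenvalue _ l1 := ordered_spectrum_eigenvalue hlam N0.
have l1_gt0 : 0 < l1 := posdef_eigenvalue posG eig1.
have /andP[_ l1N] := ordered_spectrum_bounds hlam eig1.
have lN_gt0 : 0 < lN := lt_le_trans l1_gt0 l1N.
have cN : c * lN < 2 by rewrite -ltr_pdivlMr.
have c1 : c * l1 < 2 by rewrite (le_lt_trans _ cN) // ler_pM2l.
have a0 i j : 0 <= a i j by rewrite mxE ler0n.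
have syma : a^T = a by have [syme _ _] := he; exact: trmx_adjacency.
have k_lt0 d : 0 < d -> c * d < 2 -> c ^+ 2 * d ^+ 2 - 2 * c * d < 0.
  move=> d0 cd; have -> : c ^+ 2 * d ^+ 2 - 2 * c * d = c * d * (c * d - 2) by ring.
  by rewrite pmulr_rlt0 ?mulr_gt0 // subr_lt0.
have k_diff d d' : c ^+ 2 * d' ^+ 2 - 2 * c * d' - (c ^+ 2 * d ^+ 2 - 2 * c * d) =
  c * ((d' - d) * (c * (d + d') - 2)) by ring.
have sum_gt0 : 0 < l1 + lN by exact: addr_gt0.
split=> [c_ge|c_lt] ineq; apply: distributed_riccati_control => //.
- exact: k_lt0.
- move=> d /(ordered_spectrum_bounds hlam)/andP[l1d dlN]; split=> //.
  have c2 : 2 <= c * (d + lN).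
    rewrite ler_pdivrMr // in c_ge; apply: le_trans c_ge _.
    by rewrite ler_pM2l // lerD2r.
  by rewrite -subr_ge0 k_diff mulr_ge0 ?(ltW hc_pos) // mulr_ge0 ?subr_ge0.
- exact: k_lt0.
- move=> d /(ordered_spectrum_bounds hlam)/andP[l1d dlN]; split=> //.
  have c2 : c * (d + l1) <= 2.
    rewrite ltr_pdivlMr // in c_lt; apply: le_trans (ltW c_lt).
    by rewrite ler_pM2l // addrC lerD2l.
  rewrite -subr_ge0 k_diff mulr_ge0 ?(ltW hc_pos) //.
  by rewrite mulr_le0 ?subr_le0.
Qed.
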